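(* Let $\mathcal{C}=\langle(x^n-\lambda_0)^\nu\rangle$ be a $\lambda$-constacyclic code of length $np^s$ over $\mathcal{R}_e$, where $0\le\nu\le ep^s$. Then the RT distance $d_{RT}(\mathcal{C})$ of $\mathcal{C}$ is given by $$d_{RT}(\mathcal{C})=\begin{cases} 1&\text{if }0\le\nu\le(e-1)p^s; \\ n\nu-n(e-1)p^s+1&\text{if }(e-1)p^s+1\le\nu\le ep^s-1; \\ 0&\text{if }\nu=ep^s.\end{cases}$$
   Context: $e\ge2$ is an integer and $\mathcal{R}_e$ is a finite commutative chain ring with unity, with maximal ideal $\langle\gamma\rangle$ where $\gamma$ has nilpotency index $e$; its residue field $\mathcal{R}_e/\langle\gamma\rangle$ has order $p^m$, $p$ prime. $\zeta\in\mathcal{R}_e$ has multiplicative order $p^m-1$ and $\mathcal{T}_e=\{0,1,\zeta,\dots,\zeta^{p^m-2}\}$. $n,s$ are positive integers with $\gcd(n,p)=1$. $\lambda=\lambda_0^{p^s}+\gamma\omega$ is a unit of $\mathcal{R}_e$, where $\lambda_0\in\mathcal{T}_e\setminus\{0\}$ is such that $x^n-\lambda_0$ is irreducible over $\mathcal{R}_e$, and $\omega$ is a unit in $\mathcal{R}_e$. $\lambda$-constacyclic codes of length $np^s$ over $\mathcal{R}_e$ are identified with ideals of $\mathcal{R}_e[x]/\langle x^{np^s}-\lambda\rangle$, whose elements are represented by polynomials of degree less than $np^s$. The Rosenbloom-Tsfasman (RT) weight is $w_{RT}(c(x))=1+\deg c(x)$ if $c(x)\neq0$ and $w_{RT}(0)=0$;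 $d_{RT}(\mathcal{C})=\min\{w_{RT}(c):c\in\mathcal{C}\setminus\{0\}\}$, with $d_{RT}(\{0\})=0$. *)

(* Defs.v *)
From HB Require Import structures.
From mathcomp Require Import all_boot all_order all_fingroup all_algebra.

Set Implicit Arguments.
Unset Strict Implicit.
Unset Printing Implicit Defensive.

Import GRing.Theory.
Local Open Scope ring_scope.

(* Unlike idealr_closed, the whole ring is allowed. *)
Definition is_ideal (A : finComNzRingType) (I : {set A}) : Prop :=
  0 \in I /\ forall a : A, {in I &, forall u v, a * u + v \in I}.

Definition chain_ring (A : finComNzRingType) : Prop :=
  forall I J : {set A}, is_ideal I -> is_ideal J -> I \subset J \/ J \subset I.

Definition maximal_ideal (A : finComNzRingType) (I : {set A}) : Prop :=
  [/\ is_ideal I, I != setT &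
      forall J : {set A}, is_ideal J -> I \subset J -> J = I \/ J = setT].

Definition principal_ideal (A : finComNzRingType) (a : A) : {set A} :=
  [set a * b | b : A].

(* The canonical finGroupType structure of a finite ring is its additive
   group, so this index counts the additive cosets of I. *)
Definition residue_order (A : finComNzRingType) (I : {set A}) : nat :=
  #|[set: A] : I|%g.

Definition nilpotency_index (A : nzRingType) (a : A) (e : nat) : Prop :=
  a ^+ e = 0 /\ forall k : nat, (k < e)%N -> a ^+ k != 0.

(* The set {0, 1, z, ..., z^(q-2)}. *)
Definition teichmuller_set (A : finComNzRingType) (z : A) (q : nat) : {set A} :=
  0 |: [set z ^+ i | i : 'I_(q - 1)].

Definition invertible (A : comNzRingType) (a : A) : Prop :=
  exists b : A, a * b = 1.

(* irreducible_poly is only meaningful over an integral domain; over a ring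
   with nilpotents, units of the polynomial ring need not be constant, so
   irreducibility is that of an element of the ring of polynomials. *)
Definition irreducible_elt (A : comNzRingType) (a : A) : Prop :=
  [/\ a != 0, ~ invertible a &
      forall b c : A, a = b * c -> invertible b \/ invertible c].

Definition constacyclic_poly (R : nzRingType) (N : nat) (lam : R) : {poly R} :=
  'X^N - lam%:P.

(* For N > 0, mk_monic is the identity on constacyclic_poly N lam, so the
   elements of this quotient ring are the polynomials of degree < N. *)
Notation constacyclic_ring N lam := {poly %/ constacyclic_poly N lam}.

Definition code_generated_by (R : finComNzRingType) (N : nat) (lam : R)
    (g : {poly R}) : {set constacyclic_ring N lam} :=
  [set in_qpoly (constacyclic_poly N lam) g * c | c : constacyclic_ring N lam].

(* The size of a polynomial c is 1 + deg c if c != 0, and 0 if c = 0. *)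
Definition RT_weight (R : finComNzRingType) (N : nat) (lam : R)
    (c : constacyclic_ring N lam) : nat :=
  size (c : {poly R}).

Definition RT_distance (R : finComNzRingType) (N : nat) (lam : R)
    (C : {set constacyclic_ring N lam}) : nat :=
  if [pick c in C :\ 0] is Some c0
  then RT_weight [arg min_(c < c0 in C :\ 0) RT_weight c] else 0%N.

(* Main.v *)
Require Import Defs.
From mathcomp Require Import all_boot all_order all_fingroup all_algebra.
From mathcomp Require Import cyclic ring.

(** Write f = x^n - lambda0, q = p^s and work in the quotient of R[x] by
    Q = x^(nq) - lambda.

    Since the residue field has order p^m, the prime p is a multiple of gamma
    ([natr_mem_maximal_ideal]). Expanding x^(nq) = (f + lambda0)^q modulo p
    ([prime_power_expD]) therefore gives f^q = gamma (omega + f g) in the quotient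
    ([XnsubC_prime_power]). As gamma is nilpotent so is f, hence omega + f g is a
    unit ([invertible_expr_cofactor]): f^q is gamma up to a unit, and f plays the
    role of a uniformizer of nilpotency index at most e q.

    So f^(eq) = 0, which is the zero code. If nu <= (e-1)q, the code contains
    f^((e-1)q) and hence, up to a unit, the nonzero constant gamma^(e-1) of weight
    1. If nu = (e-1)q + t with 0 < t < q, the code is generated by gamma^(e-1) f^t,
    which has degree n t < n q and thus weight n t + 1. No codeword weighs less: as
    gamma^e = 0, multiplying by gamma^(e-1) identifies Q with f^q already in R[x],
    so that the reduced representative of a codeword is still a multiple of f^t
    ([qpoly_scale_dvd]); f^t being monic, a nonzero multiple has degree at least
    n t ([leq_size_mul_monic]). *)

Set Implicit Arguments.
Unset Strict Implicit.
Unset Printing Implicit Defensive.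

Import GRing.Theory.
Local Open Scope ring_scope.

(** * Prime powers of sums *)

(** Modulo p this is additivity of the iterated Frobenius map; the point here is
    the factor d in the error term, which makes that term nilpotent as soon as d
    is. It is there because every mixed term of the expansion contains d. *)
Lemma prime_power_expD (A : comNzRingType) (p s : nat) (d b : A) :
  prime p ->
  exists h, (d + b) ^+ (p ^ s) = d ^+ (p ^ s) + b ^+ (p ^ s) + p%:R * (d * h).
Proof.
move=> p_pr.
have p_gt0 := prime_gt0 p_pr.
have expD_prime (x y : A) :
  exists h, (x + y) ^+ p = x ^+ p + y ^+ p + p%:R * (x * h).
  have [k Ep] : exists k, p = k.+2.
    by case: p p_pr {p_gt0} => [|[|k]] //; exists k.
  exists (\sum_(i < k.+1) (x ^+ (k - i) * y ^+ i.+1) *+ ('C(p, i.+1) %/ p)).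
  (* The two extreme terms are split off; p divides the other binomials, and
     their exponent of x is positive. *)
  rewrite exprDn [in LHS]Ep big_ord_recl big_ord_recr /= -Ep.
  rewrite subn0 expr0 mulr1 bin0 mulr1n /bump /= add1n -Ep subnn expr0 mul1r binn.
  rewrite mulr1n [\sum_(_ < _) _ + _]addrC addrA; congr (_ + _).
  rewrite mulr_sumr mulr_sumr; apply: eq_bigr => i _.
  rewrite add1n mulr_natl !mulrnAr -mulrnA divnK; last first.
    by rewrite prime_dvd_bin // Ep !ltnS leq_ord.
  by rewrite {1}Ep !subSS subSn ?leq_ord // exprS -mulrA.
elim: s => [|s [h IH]]; first by exists 0; rewrite expn0 !expr1 !mulr0 addr0.
rewrite expnSr !exprM IH; set q := (p ^ s)%N.
have expr_pred n (z : A) : (0 < n)%N -> z ^+ n = z * z ^+ n.-1.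
  by move=> n_gt0; rewrite -exprS prednK.
have [h1 E1] := expD_prime (d ^+ q) (b ^+ q).
have [h2 E2] := expD_prime (p%:R * (d * h)) (d ^+ q + b ^+ q).
(* The three summands come from the p-th power of the previous error term, from
   the error in (d ^+ q + b ^+ q) ^+ p, and from the mixed terms of the two. *)
exists (h * (p%:R * (d * h)) ^+ p.-1 + d ^+ q.-1 * h1 + p%:R * h * h2).
rewrite addrC E2 E1 (expr_pred p (p%:R * _)) //.
rewrite [X in p%:R * (X * h1)]expr_pred ?expn_gt0 ?p_gt0 //.
ring.
Qed.

(** * Units, nilpotents and the residue characteristic *)

(** Writing u + x = u (1 - y) with y nilpotent, the inverse of 1 - y is a
    geometric sum. *)
Lemma invertible_nilpotentD (A : comNzRingType) (u x : A) (k : nat) :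
  invertible u -> x ^+ k = 0 -> invertible (u + x).
Proof.
case=> v uv xk0; pose y := - (v * x).
have yk0 : y ^+ k = 0 by rewrite exprNn exprMn xk0 !mulr0.
exists (v * \sum_(i < k) y ^+ i).
have -> : u + x = u * (1 - y) by rewrite mulrBr mulr1 mulrN mulrA uv mul1r opprK.
rewrite mulrACA uv mul1r -[LHS]opprK -mulNr opprB -subrX1 yk0 sub0r.
by rewrite opprK.
Qed.

Lemma principal_ideal_is_ideal (A : finComNzRingType) (a : A) :
  is_ideal (principal_ideal a).
Proof.
split; first by apply/imsetP; exists 0; rewrite ?mulr0.
move=> c _ _ /imsetP[x _ ->] /imsetP[y _ ->].
by apply/imsetP; exists (c * x + y); rewrite // mulrDr mulrCA.
Qed.

(** Lagrange's theorem in the additive quotient by I: the class of 1 is killed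
    by the order of the quotient. *)
Lemma natr_residue_order_mem (A : finComNzRingType) (I : {set A}) :
  is_ideal I -> (residue_order I)%:R \in I.
Proof.
move=> [I0 Ilin].
have I_group : group_set I.
  apply/group_setP; split=> // x y xI yI.
  by have := Ilin 1 x y xI yI; rewrite mul1r.
pose H := Group I_group.
have nHA : (H <| [set: A]%G)%g.
  by rewrite -sub_abelian_normal ?subsetT // FinRing.zmod_abelian.
rewrite -[residue_order I]/#|[set: A] : H|%g -card_quotient ?normal_norm //.
rewrite -FinRing.zmodXgE -[I]/(gval H).
have NH x : x \in 'N(H)%g by rewrite (subsetP (normal_norm nHA)) ?inE.
apply: coset_idr => //; rewrite morphX ?NH //.
by rewrite expg_cardG ?mem_quotient ?inE.
Qed.

(** The residue order p ^ m lies in the ideal of the nilpotent element a, so p is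
    nilpotent, and a nilpotent element lies in every maximal ideal: otherwise 1
    would be a sum of two nilpotents. *)
Lemma natr_mem_maximal_ideal (A : finComNzRingType) (a : A) (e p m : nat) :
  maximal_ideal (principal_ideal a) -> a ^+ e = 0 ->
  residue_order (principal_ideal a) = (p ^ m)%N ->
  exists c : A, p%:R = a * c.
Proof.
move=> [Iideal _ Imax] ae0 residue.
have [c pmE] : exists c : A, p%:R ^+ m = a * c.
  have := natr_residue_order_mem Iideal.
  by rewrite residue natrX => /imsetP[c _ ->]; exists c.
have p_nil : p%:R ^+ (m * e) = 0 :> A by rewrite exprM pmE exprMn ae0 mul0r.
pose J := [set a * x.1 + p%:R * x.2 | x : A * A].
have memJ x y : a * x + p%:R * y \in J by apply/imsetP; exists (x, y).
have Jideal : is_ideal J.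
  split; first by rewrite -(addr0 0) -{1}(mulr0 a) -(mulr0 p%:R) memJ.
  move=> b _ _ /imsetP[[x y] _ ->] /imsetP[[z t] _ ->] /=.
  by rewrite mulrDr !(mulrCA b) addrACA -!mulrDr memJ.
have IJ : principal_ideal a \subset J.
  apply/subsetP=> _ /imsetP[x _ ->].
  by have := memJ x 0; rewrite mulr0 addr0.
have pJ : p%:R \in J by have := memJ 0 1; rewrite mulr0 add0r mulr1.
have [JE | JT] := Imax J Jideal IJ.
  by move: pJ; rewrite JE => /imsetP[x _ ->]; exists x.
have /imsetP[[x y] _ /= E1] : 1 \in J by rewrite JT inE.
have [z py_unit] : invertible (p%:R * y).
  have -> : p%:R * y = 1 + - (a * x).
    by apply: (addrI (a * x)); rewrite -E1 addrCA subrr addr0.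
  apply: (@invertible_nilpotentD _ _ _ e); first by exists 1; rewrite mulr1.
  by rewrite exprNn exprMn ae0 mul0r mulr0.
have := expr1n A (m * e); rewrite -[X in X ^+ _]py_unit !exprMn p_nil !mul0r.
by move/esym/eqP; rewrite oner_eq0.
Qed.

(** The hypothesis makes f itself nilpotent, so the correction f * g to the unit
    u is nilpotent. *)
Lemma invertible_expr_cofactor (A : comNzRingType) (f g z u : A) (q e : nat) :
  invertible u -> z ^+ e = 0 -> f ^+ q = z * (u + f * g) ->
  invertible (u + f * g).
Proof.
move=> u_inv ze0 fqE; apply: (@invertible_nilpotentD _ _ _ (q * e)) => //.
by rewrite exprMn exprM fqE exprMn ze0 !mul0r.
Qed.

(** * Polynomials with a monic factor *)

Lemma leq_size_mul_monic (R : nzRingType) (f g : {poly R}) :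
  f \is monic -> f * g != 0 -> (size f <= size (f * g)%R)%N.
Proof.
move=> f_mon fg0.
have g0 : g != 0 by apply: contraNneq fg0 => ->; rewrite mulr0.
rewrite size_monicM //; move: g0; rewrite -size_poly_gt0.
by case: (size g) => // k _; rewrite addnS leq_addr.
Qed.

Lemma size_monic_exp (R : nzRingType) (f : {poly R}) (k : nat) :
  f \is monic -> size (f ^+ k) = ((size f).-1 * k).+1.
Proof.
move=> f_mon; elim: k => [|k IH]; first by rewrite expr0 size_poly1 muln0.
rewrite exprS size_monicM ?monic_neq0 ?monic_exp // IH.
by rewrite addnS /= mulnS -addSn prednK // size_poly_gt0 monic_neq0.
Qed.

(** Reducing modulo the defining polynomial h usually destroys divisibility by
    f ^+ t. It does not for multiples of a: the multiple of h subtracted can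
    be taken scaled by a, and a *: h is then a multiple of f ^+ q. *)
Lemma qpoly_scale_dvd (R : comNzRingType) (a : R) (h f : {poly R}) (q t : nat)
    (z : {poly %/ h}) :
  a *: mk_monic h = a *: f ^+ q -> (t <= q)%N ->
  exists d, (in_qpoly h (a *: f ^+ t) * z : {poly R}) = f ^+ t * d.
Proof.
move=> ahE le_tq; have h_mon := monic_mk_monic h.
pose r := Pdiv.CommonRing.rdivp (f ^+ t * z) (mk_monic h).
exists (a *: ((z : {poly R}) - f ^+ (q - t) * r)).
rewrite poly_of_qpolyM /= Pdiv.RingMonic.rmodp_mulml // -scalerAl.
rewrite Pdiv.RingMonic.rmodpZ //.
have -> : Pdiv.CommonRing.rmodp (f ^+ t * z) (mk_monic h) =
    f ^+ t * z - r * mk_monic h.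
  by rewrite [X in X - _](Pdiv.RingMonic.rdivp_eq h_mon) addrC addKr.
rewrite -scalerAr mulrBr !scalerBr; congr (_ - _).
by rewrite scalerAr ahE -scalerAr mulrA -exprD subnKC // mulrC.
Qed.

(** * Rosenbloom-Tsfasman distance and constacyclic moduli *)

Lemma RT_distance_min (R : finComNzRingType) (N : nat) (lam : R)
    (C : {set constacyclic_ring N lam}) (c0 : constacyclic_ring N lam) :
  c0 \in C -> c0 != 0 ->
  (forall c, c \in C -> c != 0 -> (RT_weight c0 <= RT_weight c)%N) ->
  RT_distance C = RT_weight c0.
Proof.
move=> c0C c0nz minc0; rewrite /RT_distance.
case: pickP => [c1 c1C | noC]; last by have := noC c0; rewrite !inE c0nz c0C.
case: arg_minnP => // c; rewrite !inE => /andP[c_nz cC] minc.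
apply/eqP; rewrite eqn_leq minc0 // andbT minc //.
by rewrite !inE c0nz.
Qed.

Lemma RT_distance0 (R : finComNzRingType) (N : nat) (lam : R)
    (C : {set constacyclic_ring N lam}) :
  (forall c, c \in C -> c = 0) -> RT_distance C = 0%N.
Proof.
move=> C0; rewrite /RT_distance; case: pickP => // c.
by rewrite !inE => /andP[c_nz /C0 c0]; rewrite c0 eqxx in c_nz.
Qed.

Lemma mk_monic_constacyclic (R : nzRingType) (N : nat) (lam : R) :
  (0 < N)%N -> mk_monic (constacyclic_poly N lam) = constacyclic_poly N lam.
Proof.
by move=> N_gt0; rewrite /mk_monic size_XnsubC // ltnS N_gt0 monicXnsubC.
Qed.

(** Modulo the constacyclic polynomial, f ^+ (p ^ s) becomes gamma times a sum of
    the unit omega and a multiple of f, because p is a multiple of gamma. *)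
Lemma XnsubC_prime_power (R : comNzRingType) (gamma omega c l0 : R)
    (p s n : nat) :
  prime p -> p%:R = gamma * c ->
  exists g : {poly R}, ('X^n - l0%:P) ^+ (p ^ s) =
    constacyclic_poly (n * p ^ s) (l0 ^+ (p ^ s) + gamma * omega)
    + gamma *: (omega%:P + ('X^n - l0%:P) * g).
Proof.
move=> p_pr pE; set f := 'X^n - l0%:P.
have [h] := prime_power_expD s f l0%:P p_pr.
rewrite subrK -exprM => XNE.
exists (- (c *: h)).
rewrite /constacyclic_poly XNE polyCD polyCM polyC_exp -polyC_natr pE.
rewrite polyCM -!mul_polyC; ring.
Qed.

(** * The distance of the codes generated by powers of x^n - lambda0 *)

Theorem theorem4p3 (R : finComUnitRingType) (gamma zeta lambda lambda0 omega : R)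
    (e p m n s nu : nat)
  (e_ge2 : (2 <= e)%N)
  (chainR : chain_ring R)
  (gamma_max : maximal_ideal (principal_ideal gamma))
  (gamma_nil : nilpotency_index gamma e)
  (p_prime : prime p)
  (residue : residue_order (principal_ideal gamma) = (p ^ m)%N)
  (zeta_order : (p ^ m - 1)%N.-primitive_root zeta)
  (n_gt0 : (0 < n)%N) (s_gt0 : (0 < s)%N) (coprime_np : gcdn n p = 1%N)
  (lambda0T : lambda0 \in teichmuller_set zeta (p ^ m) :\ 0)
  (lambda0_irr : irreducible_elt ('X^n - lambda0%:P))
  (omega_unit : omega \is a GRing.unit)
  (lambdaE : lambda = lambda0 ^+ (p ^ s) + gamma * omega)
  (lambda_unit : lambda \is a GRing.unit)
  (nu_le : (nu <= e * p ^ s)%N) :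
  let C := code_generated_by (n * p ^ s) lambda (('X^n - lambda0%:P) ^+ nu) in
  [/\ (nu <= (e - 1) * p ^ s)%N -> RT_distance C = 1%N,
      ((e - 1) * p ^ s + 1 <= nu <= e * p ^ s - 1)%N ->
        RT_distance C = (n * nu - n * (e - 1) * p ^ s + 1)%N
    & nu = (e * p ^ s)%N -> RT_distance C = 0%N].
Proof.
have [gamma_e0 gamma_min] := gamma_nil.
have e_gt0 : (0 < e)%N by exact: ltnW.
have gamma_e1 : gamma ^+ (e - 1) != 0 by rewrite gamma_min // subn1 prednK.
have [c pE] := natr_mem_maximal_ideal gamma_max gamma_e0 residue.
have [g] := XnsubC_prime_power omega lambda0 s n p_prime pE.
rewrite -lambdaE; set q := (p ^ s)%N; set f := 'X^n - lambda0%:P => fqE C.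
have q_gt0 : (0 < q)%N by rewrite expn_gt0 prime_gt0.
have N_gt0 : (0 < n * q)%N by rewrite muln_gt0 n_gt0.
set Q := constacyclic_poly _ lambda in fqE C *.
have QE : mk_monic Q = Q by apply: mk_monic_constacyclic.
have Q_monic : Q \is monic by apply: monicXnsubC.
have f_monic : f \is monic by apply: monicXnsubC.
have size_f t : size (f ^+ t) = (n * t).+1.
  by rewrite size_monic_exp // size_XnsubC.
pose phi := in_qpoly Q.
have phiD a b : phi (a + b) = phi a + phi b by exact: in_qpolyD.
have phiM a b : phi (a * b) = phi a * phi b by exact: in_qpolyM.
have phi1 : phi 1 = 1 by exact: in_qpoly1.
have phiX a k : phi (a ^+ k) = phi a ^+ k by exact: (rmorphXn (in_qpoly Q)).
have phiQ : phi Q = 0 by apply: val_inj; rewrite /= QE Pdiv.RingMonic.rmodpp.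
have phifq : phi f ^+ q = phi gamma%:P * (phi omega%:P + phi f * phi g).
  by rewrite -phiX fqE phiD phiQ add0r -mul_polyC phiM phiD phiM.
have phi_gamma_e : phi gamma%:P ^+ e = 0.
  by rewrite -phiX -polyC_exp gamma_e0; exact: in_qpoly0.
(* u is the unit with f ^+ q = gamma u in the quotient ring. *)
have [u' uu'] : invertible (phi omega%:P + phi f * phi g).
  apply: invertible_expr_cofactor phi_gamma_e phifq.
  exists (phi (omega^-1)%:P).
  by rewrite -phiM -polyCM divrr.
set u := (phi omega%:P + _) in phifq uu'.
(* For nu = (e - 1) q + t, the polynomial gamma ^+ (e - 1) *: f ^+ t generates the
   same code as f ^+ nu; its degree n t is what the distance measures. *)
have phi_split t : phi (f ^+ ((e - 1) * q + t)) =
    phi (gamma ^+ (e - 1) *: f ^+ t) * u ^+ (e - 1).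
  rewrite -mul_polyC polyC_exp !phiM !phiX exprD mulnC exprM phifq exprMn.
  by rewrite mulrAC.
have memC t : (nu <= (e - 1) * q + t)%N ->
    phi (gamma ^+ (e - 1) *: f ^+ t) \in C.
  move=> le_nu; apply/imsetP.
  exists (phi (f ^+ ((e - 1) * q + t - nu)) * u' ^+ (e - 1)) => //.
  rewrite mulrA -[in_qpoly _ _]/(phi _) -phiM -exprD subnKC //.
  by rewrite phi_split -mulrA -exprMn uu' expr1n mulr1.
have size_gen t : size (gamma ^+ (e - 1) *: f ^+ t) = (n * t).+1.
  rewrite -mul_polyC size_Mmonic ?polyC_eq0 ?monic_exp // size_f.
  by rewrite size_polyC gamma_e1.
have weight_gen t : (t < q)%N ->
    RT_weight (phi (gamma ^+ (e - 1) *: f ^+ t)) = (n * t).+1.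
  move=> lt_tq; rewrite /RT_weight in_qpoly_small // QE size_gen.
  by rewrite size_XnsubC // ltnS ltn_mul2l n_gt0.
have weight_gt0 (x : {poly %/ Q}) : x != 0 -> (0 < RT_weight x)%N.
  by rewrite /RT_weight size_poly_gt0.
have gen_neq0 t : (t < q)%N -> phi (gamma ^+ (e - 1) *: f ^+ t) != 0.
  move=> /weight_gen; apply: contra_eqN => /eqP->.
  by rewrite /RT_weight size_poly0.
split.
- move=> le_nu.
  (* t = 0: the code contains the nonzero constant gamma ^+ (e - 1). *)
  rewrite (@RT_distance_min _ _ _ _ (phi (gamma ^+ (e - 1) *: f ^+ 0))).
  + by rewrite weight_gen // muln0.
  + by rewrite memC // addn0.
  + exact: gen_neq0.
  by move=> x _ /weight_gt0; rewrite weight_gen // muln0.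
- case/andP=> lb ub.
  pose t := (nu - (e - 1) * q)%N.
  have nuE : nu = ((e - 1) * q + t)%N by rewrite subnKC // ltnW // -addn1.
  have lt_tq : (t < q)%N.
    rewrite ltn_subLR; last by rewrite ltnW // -addn1.
    rewrite -mulSnr -[in X in (nu < X)%N]subSn // subn1 /=.
    apply: leq_ltn_trans ub _; rewrite ltn_subrL /= muln_gt0 e_gt0 q_gt0 //.
  rewrite (@RT_distance_min _ _ _ _ (phi (gamma ^+ (e - 1) *: f ^+ t))).
  + by rewrite weight_gen // -mulnA -mulnBr addn1.
  + by rewrite memC // -nuE.
  + exact: gen_neq0.
  move=> x /imsetP[y _ ->]; rewrite nuE [in_qpoly _ _]phi_split -mulrA.
  set z := u ^+ _ * y => x_neq0.
  rewrite weight_gen // -size_f.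
  (* f ^+ q and Q differ by a multiple of gamma, killed by gamma ^+ (e - 1). *)
  have gQ : gamma ^+ (e - 1) *: mk_monic Q = gamma ^+ (e - 1) *: f ^+ q.
    by rewrite QE fqE [in RHS]scalerDr scalerA -exprSr subn1 prednK //
      gamma_e0 scale0r addr0.
  have [d dE] := qpoly_scale_dvd z gQ (ltnW lt_tq).
  rewrite /RT_weight dE; apply: leq_size_mul_monic; first exact: monic_exp.
  by rewrite -dE.
move=> nuE; apply: RT_distance0 => x /imsetP[y _ ->].
have phifqe0 : phi f ^+ (e * q) = 0.
  by rewrite mulnC exprM phifq exprMn phi_gamma_e mul0r.
by rewrite -[in_qpoly _ _]/(phi _) phiX nuE phifqe0 mul0r.
Qed.
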